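(* Let $1\le k\le n$, let $X_1,\ldots,X_n,Z$ be independent and non-negative random variables, and let $T=\min(X_{n-k+1:n}+Z,\,X_{n-k+2:n})$. Assume that $X_1,\ldots,X_n$ either are continuously distributed and have the same support, which is an interval, or are discretely distributed with support $\{0,1,\ldots,N\}$, $N\le\infty$. Let $supp(X)$ denote the common support of $X_1,\ldots,X_n$ and set $\mathcal T=\{t\in supp(X): P(X_{1:n}>t)>0\}$. If $X_1,\ldots,X_n$ have IFR (respectively DFR) distributions, then $[T-t\mid X_{1:n}>t]$ is stochastically decreasing (respectively increasing) in $t\in\mathcal T$, in the sense that for any $t_1<t_2$ with $t_1,t_2\in\mathcal T$, $$[T-t_1\mid X_{1:n}>t_1]\ \ge_{st}\ (\text{respectively }\le_{st})\ [T-t_2\mid X_{1:n}>t_2],$$ which implies that $E(T-t\mid X_{1:n}>t)$ is decreasing (respectively increasing) in $t\in\mathcal T$.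
   Context: $X_{1:n}\le\cdots\le X_{n:n}$ are the order statistics of $X_1,\ldots,X_n$ and $X_{n+1:n}:=\infty$; $T$ is the lifetime of a $k$-out-of-$n$ system with one cold standby unit of lifetime $Z$. ''Increasing''/''decreasing'' mean non-decreasing/non-increasing; expectations are in $[0,\infty]$. If $N=\infty$ the support is the set of all non-negative integers. $X\le_{st}Y$ (equivalently $Y\ge_{st}X$) means $P(X>s)\le P(Y>s)$ for all $s$. For an event $A$ with positive probability, $[X\mid A]$ denotes a random variable having the conditional distribution of $X$ given $A$. IFR (DFR): a non-negative random variable $X$ with a continuous distribution whose support is an interval, or with a discrete distribution with support $\{0,1,\ldots,N\}$, $N\le\infty$, has an increasing (decreasing) failure rate distribution if for any $t_1\le t_2$ in the support of $X$ with $P(X>t_2)>0$ one has $P(X-t_1>s\mid X>t_1)\ge(\le)\,P(X-t_2>s\mid X>t_2)$ for all $s\in\mathbb R$. *)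

(* Defs.v *)
From HB Require Import structures.
From mathcomp Require Import all_boot all_order all_algebra.
From mathcomp Require Import all_classical all_reals all_analysis.

Set Implicit Arguments.
Unset Strict Implicit.
Unset Printing Implicit Defensive.

Import Order.TTheory GRing.Theory Num.Theory.
Import numFieldNormedType.Exports.

Local Open Scope classical_set_scope.
Local Open Scope ring_scope.
Local Open Scope ereal_scope.

Section Conditioning.
Context {d : measure_display} {Omega : measurableType d} {R : realType}.
Variable P : probability Omega R.

(* P(A | B), meaningful when P B > 0. *)
Definition cond_prob (A B : set Omega) : \bar R := P (A `&` B) / P B.

(* The law of [Y | A], for an extended-real-valued Y. *)
Definition cond_law (Y : Omega -> \bar R) (A : set Omega) :
    set (\bar R) -> \bar R :=
  fun B => cond_prob (Y @^-1` B) A.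

(* E(Y | A) = E(Y 1_A) / P(A), in [0, +oo] when Y >= 0 on A. *)
Definition cond_expectation (Y : Omega -> \bar R) (A : set Omega) : \bar R :=
  (\int[P]_(w in A) Y w) / P A.

Definition mutually_independent (I : finType) (X : I -> {RV P >-> R}) :=
  forall (J : {set I}) (B : I -> set R), (forall i, measurable (B i)) ->
    P (\bigcap_(i in [set` J]) (X i @^-1` B i)) =
    \big[*%E/1]_(i in J) P (X i @^-1` B i).

End Conditioning.

(* Usual stochastic order between two laws on \bar R. *)
Definition st_le (R : realType) (mu nu : set (\bar R) -> \bar R) :=
  forall s : R, mu [set y | s%:E < y] <= nu [set y | s%:E < y].

Section Lifetimes.
Context {d : measure_display} {Omega : measurableType d} {R : realType}.
Variable P : probability Omega R.
Implicit Type X : {RV P >-> R}.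

(* Topological support of the distribution of X. *)
Definition rv_support X : set R :=
  [set x | forall U : set R, open U -> U x -> 0 < distribution P X U].

(* {0, 1, ..., N}; N = None stands for N = oo. *)
Definition initial_nats (N : option nat) : set R :=
  [set x | exists2 j : nat,
    (if N is Some m then (j <= m)%N else true) & x = j%:R%R].

Definition continuous_on_interval X :=
  continuous (cdf X) /\ is_interval (rv_support X).

Definition discrete_on_nats (N : option nat) X :=
  (exists2 C : set R, countable C & distribution P X C = 1) /\
  rv_support X = initial_nats N.

(* The random variables for which IFR and DFR are defined. *)
Definition lifetime_rv X :=
  (forall w, (0 <= X w)%R) /\
  (continuous_on_interval X \/ exists N, discrete_on_nats N X).

(* P(X - t > s | X > t) *)
Definition residual_survival X (t s : R) : \bar R :=
  cond_prob P [set w | (s < X w - t)%R] [set w | (t < X w)%R].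

Definition IFR X := lifetime_rv X /\
  forall t1 t2 : R, (t1 <= t2)%R -> rv_support X t1 -> rv_support X t2 ->
    0 < P [set w | (t2 < X w)%R] ->
    forall s : R, residual_survival X t2 s <= residual_survival X t1 s.

Definition DFR X := lifetime_rv X /\
  forall t1 t2 : R, (t1 <= t2)%R -> rv_support X t1 -> rv_support X t2 ->
    0 < P [set w | (t2 < X w)%R] ->
    forall s : R, residual_survival X t1 s <= residual_survival X t2 s.

End Lifetimes.

(* The r-th smallest of x_1, ..., x_n, with r counted from 1; the default value
   of nth implements the convention x_(n+1:n) = oo. *)
Definition order_stat (R : realType) (n : nat) (x : 'I_n -> R) (r : nat) :
    \bar R :=
  nth +oo [seq y%:E | y <- sort <=%R [seq x i | i <- enum 'I_n]] r.-1.

(* Lifetime of a k-out-of-n system with component lifetimes x_1, ..., x_n and a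
   cold standby unit of lifetime z. *)
Definition standby_lifetime (R : realType) (n k : nat) (x : 'I_n -> R) (z : R) :
    \bar R :=
  Order.min (order_stat x (n - k + 1) + z%:E) (order_stat x (n - k + 2)).

(* Main.v *)
(* Given X_(1:n) > t, the residual lifetimes X_i - t are still independent, and
   IFR (DFR) makes each of them stochastically monotone in t; T - t is an
   increasing function of these residual lifetimes and of Z, hence inherits the
   monotonicity. For a fixed value z of Z the event T - t > s depends on X_i - t
   only through its position relative to s - z and s, so the comparison reduces
   to the probability of an up-set in a finite product of chains, where a
   quantile coupling settles it. Simple functions increasing to Z give the
   general case, and integrating survival functions gives the means. *)

Require Import Defs.
From HB Require Import structures.
From mathcomp Require Import all_boot all_order all_algebra.
From mathcomp Require Import all_classical all_reals all_analysis.
From mathcomp Require Import measurable_realfun lra.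

Set Implicit Arguments.
Unset Strict Implicit.
Unset Printing Implicit Defensive.

Import Order.TTheory GRing.Theory Num.Theory.
Import numFieldNormedType.Exports.

Local Open Scope classical_set_scope.
Local Open Scope ring_scope.
Local Open Scope ereal_scope.

(** * Quantile coupling of two laws on a finite chain *)

Section QuantileCoupling.
Local Open Scope ring_scope.
Context {R : realFieldType}.
Implicit Types p q : nat -> R.

(* The joint law with joint survival function min (p a) (q b), the marginal
   survival functions being p and q. *)
Definition quantile_coupling p q (a b : nat) : R :=
  (Num.min (p a) (q b) - Num.min (p a.+1) (q b)) -
  (Num.min (p a) (q b.+1) - Num.min (p a.+1) (q b.+1)).

(** The minimum is supermodular, so its mixed increment over a rectangle is nonnegative. *)
Lemma quantile_coupling_ge0 p q a b :
  p a.+1 <= p a -> q b.+1 <= q b -> 0 <= quantile_coupling p q a b.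
Proof.
by move=> ? ?; rewrite /quantile_coupling /Num.min; do 4! case: ltP => ?; lra.
Qed.

(** For b < a, a non-increasing [p] satisfies [p a <= p b.+1]; all four minima are then values of
    [p] and cancel. So the coupling puts no mass on pairs with b < a. *)
Lemma quantile_coupling_eq0 p q a b :
  p a.+1 <= p a -> p a <= p b.+1 -> p b.+1 <= q b.+1 -> q b.+1 <= q b ->
  quantile_coupling p q a b = 0.
Proof.
by move=> ? ? ? ?; rewrite /quantile_coupling /Num.min; do 4! case: ltP => ?; lra.
Qed.

(** The sum telescopes in b: at b = 0 both minima are values of [p], since [q 0] dominates them, and
    at b = m both are 0. *)
Lemma sum_quantile_couplingl p q m a :
  p a.+1 <= p a -> p a <= q 0 -> q m = 0 -> 0 <= p a.+1 ->
  \sum_(b < m) quantile_coupling p q a b = p a - p a.+1.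
Proof.
move=> pa paq qm pa0.
rewrite -(big_mkord xpredT (quantile_coupling p q a)).
rewrite (eq_bigr (fun b => (Num.min (p a.+1) (q b.+1) - Num.min (p a) (q b.+1)) -
    (Num.min (p a.+1) (q b) - Num.min (p a) (q b)))) => [|b _]; last first.
  by rewrite /quantile_coupling; lra.
rewrite telescope_sumr // qm (min_l (le_trans pa paq)) (min_l paq).
by rewrite (min_r pa0) (min_r (le_trans pa0 pa)); lra.
Qed.

Lemma quantile_couplingC p q a b :
  quantile_coupling p q a b = quantile_coupling q p b a.
Proof.
rewrite /quantile_coupling ![Num.min (q _) _]minC.
by lra.
Qed.

End QuantileCoupling.

(** * Up-set probabilities in a finite product of chains *)

Section ProductOrder.
Local Open Scope ring_scope.
Context {R : realFieldType} {I : finType} {m : nat}.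

(* Under the coupling, the first coordinatewise variable is almost surely below
   the second, so it lies in the up-set U only if the second does. *)
Lemma le_prob_upset (p q : I -> nat -> R) (U : pred {ffun I -> 'I_m}) :
  (forall i, p i 0%N = 1) -> (forall i, q i 0%N = 1) ->
  (forall i, p i m = 0) -> (forall i, q i m = 0) ->
  (forall i, {homo p i : a b / (a <= b)%N >-> b <= a}) ->
  (forall i, {homo q i : a b / (a <= b)%N >-> b <= a}) ->
  (forall i a, p i a <= q i a) ->
  (forall c d : {ffun I -> 'I_m}, (forall i, (c i <= d i)%N) -> U c -> U d) ->
  \sum_(c | U c) \prod_i (p i (c i) - p i (c i).+1) <=
  \sum_(c | U c) \prod_i (q i (c i) - q i (c i).+1).
Proof.
move=> p0 q0 pm qm p_ni q_ni pq upU.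
have p_ge0 i a : (a <= m)%N -> 0 <= p i a by move=> am; rewrite -(pm i) p_ni.
have q_ge0 i a : (a <= m)%N -> 0 <= q i a by move=> am; rewrite -(qm i) q_ni.
have p_le1 i a : p i a <= 1 by rewrite -(p0 i) p_ni.
have q_le1 i a : q i a <= 1 by rewrite -(q0 i) q_ni.
pose K i (a b : 'I_m) := quantile_coupling (p i) (q i) a b.
(* The product of the couplings is a law on pairs (c, d); [marg_p] and [marg_q] identify its
   marginals with the two product laws. *)
have marg_p (c : {ffun I -> 'I_m}) :
    \prod_i (p i (c i) - p i (c i).+1) =
    \sum_(d : {ffun I -> 'I_m}) \prod_i K i (c i) (d i).
  rewrite -(bigA_distr_bigA (fun i => K i (c i))) /=; apply: eq_bigr => i _.
  by rewrite sum_quantile_couplingl ?p_ni ?q0 ?p_ge0.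
have marg_q (d : {ffun I -> 'I_m}) :
    \prod_i (q i (d i) - q i (d i).+1) =
    \sum_(c : {ffun I -> 'I_m}) \prod_i K i (c i) (d i).
  rewrite -(bigA_distr_bigA (fun i b => K i b (d i))) /=; apply: eq_bigr => i _.
  under eq_bigr do rewrite /K quantile_couplingC.
  by rewrite sum_quantile_couplingl ?q_ni ?p0 ?q_ge0.
rewrite (eq_bigr _ (fun c _ => marg_p c)) (eq_bigr _ (fun c _ => marg_q c)).
(* Both sides now sum the same weights over pairs (c, d), restricted to [U c] on the left and to
   [U d] on the right. *)
rewrite [leRHS]exchange_big /= [leLHS]big_mkcond /=.
apply: ler_sum => c _; rewrite [leRHS]big_mkcond /=.
have K_ge0 (d : {ffun I -> 'I_m}) : 0 <= \prod_i K i (c i) (d i).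
  by apply: prodr_ge0 => i _; apply: quantile_coupling_ge0; rewrite ?p_ni ?q_ni.
case: ifP => Uc; last by apply: sumr_ge0 => d _; case: ifP.
apply: ler_sum => d _; case: ifPn => // nUd.
(* Since U is an up-set, c is not below d; the coupling factor at a coordinate where d is smaller
   vanishes. *)
have /existsP[i dc] : [exists i, (d i < c i)%N].
  apply: contraR nUd => /existsPn cd; apply: upU Uc => i.
  by rewrite leqNgt cd.
rewrite (bigD1 i) //= /K quantile_coupling_eq0 ?mul0r //; rewrite ?p_ni ?q_ni //.
Qed.

End ProductOrder.

(** * Order statistics and the standby lifetime through failure counts *)

Section OrderStatistics.
Context {R : realType} {n : nat}.
Implicit Types (x : 'I_n -> R) (v z : R) (r k : nat).

(** In the sorted list the entries at most v form an initial segment, whose length decides whether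
    the entry of index r exceeds v. For r >= n both sides hold, the left one by the default value
    [+oo]. *)
Lemma lt_order_stat x r v :
  (v%:E < order_stat x r.+1) = (#|[set i | (x i <= v)%R]%SET| <= r)%N.
Proof.
rewrite /order_stat /=; set s := sort _ _.
have s_sorted : sorted <=%R s by apply: sort_sorted; exact: le_total.
have s_size : size s = n by rewrite size_sort size_map -cardE card_ord.
have -> : #|[set i | (x i <= v)%R]%SET| = count (fun y => y <= v)%R s.
  rewrite count_sort count_map cardsE cardE enumT size_filter.
  by apply: eq_count => i; rewrite inE.
have [rn|nr] := ltnP r n; last first.
  rewrite nth_default ?size_map ?s_size // ltry.
  by rewrite (leq_trans _ nr) // -s_size count_size.
rewrite (nth_map 0%R) ?s_size // lte_fin.
have [cr|rc] := leqP.
  by apply: nth_count_gt => //; rewrite cr s_size.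
by apply/negbTE; rewrite -leNgt; apply: nth_count_le.
Qed.

Lemma order_stat_fin_num x r : (r < n)%N -> order_stat x r.+1 \is a fin_num.
Proof.
move=> rn; rewrite /order_stat (nth_map 0%R) //.
by rewrite size_sort size_map -cardE card_ord.
Qed.

Lemma lt_order_stat1 x v : (v%:E < order_stat x 1) <-> (forall i, (v < x i)%R).
Proof.
rewrite lt_order_stat leqn0 cards_eq0; split.
  by move=> /eqP/setP x0 i; move: (x0 i); rewrite !inE ltNge => ->.
move=> vx; apply/eqP/setP => i; rewrite !inE; apply/negbTE.
by rewrite -ltNge.
Qed.

(** For fixed z this leaves two failure counts, at v - z and at v, so three levels per component
    carry all the information needed. *)
Lemma lt_standby_lifetime k x z v :
  (v%:E < standby_lifetime k x z) =
  (#|[set i | (x i <= v - z)%R]%SET| <= n - k)%N &&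
  (#|[set i | (x i <= v)%R]%SET| <= (n - k).+1)%N.
Proof.
rewrite /standby_lifetime lt_min addn1 addn2 -!lt_order_stat EFinB.
by rewrite lteBlDr.
Qed.

Lemma standby_lifetime_fin_num k x z : (1 <= k <= n)%N ->
  standby_lifetime k x z \is a fin_num.
Proof.
move=> /andP[k0 kn]; have nkn : (n - k < n)%N by rewrite ltn_subrL k0 (leq_trans k0).
rewrite /standby_lifetime addn1 addn2.
have /fineK <- := order_stat_fin_num x nkn.
have [kn'|nk] := ltnP (n - k).+1 n.
  have /fineK <- := order_stat_fin_num x kn'.
  by rewrite -EFinD /Order.min; case: ifP.
(* Here k = 1: the second order statistic has rank n + 1 and equals [+oo], so the minimum is the
   finite first term. *)
rewrite [order_stat x _.+2]nth_default ?miney //.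
by rewrite size_map size_sort size_map -cardE card_ord.
Qed.

Lemma lt_standby_lifetime_min k x z v : (0 <= z)%R -> (forall i, (v < x i)%R) ->
  v%:E < standby_lifetime k x z.
Proof.
move=> z0 vx; rewrite lt_standby_lifetime.
have card0 (u : R) : (u <= v)%R -> #|[set i | (x i <= u)%R]%SET| = 0%N.
  move=> uv; apply/eqP; rewrite cards_eq0; apply/eqP/setP => i.
  by rewrite !inE; apply/negbTE; rewrite -ltNge (le_lt_trans uv).
by rewrite !card0 // lerBlDr lerDl.
Qed.

End OrderStatistics.

(** * Product formulas for events given by levels of independent variables *)

Section Independence.
Context {d : measure_display} {Omega : measurableType d} {R : realType}.
Variables (P : probability Omega R) (n : nat).
Variables (X : 'I_n -> {RV P >-> R}) (Z : {RV P >-> R}).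
Hypothesis indepXZ :
  mutually_independent (fun j : option 'I_n => if j is Some i then X i else Z).

Let pr (A : set Omega) : R := fine (P A).

Let prE A : measurable A -> P A = (pr A)%:E.
Proof. by move=> mA; rewrite fineK // fin_num_measure. Qed.

Let mX i (D : set R) : measurable D -> measurable (X i @^-1` D).
Proof. by move=> mD; rewrite -[_ @^-1` _]setTI; exact: measurable_funP. Qed.

Let mZ (D : set R) : measurable D -> measurable (Z @^-1` D).
Proof. by move=> mD; rewrite -[_ @^-1` _]setTI; exact: measurable_funP. Qed.

Lemma measurable_rectangle (B : set R) (H : 'I_n -> set R) :
  measurable B -> (forall i, measurable (H i)) ->
  measurable [set w | B (Z w) /\ forall i, H i (X i w)].
Proof.
move=> mB mH.
rewrite (_ : mkset _ = Z @^-1` B `&` \bigcap_(i in [set: 'I_n]) (X i @^-1` H i)).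
  apply: measurableI; first exact: mZ.
  by apply: fin_bigcap_measurable => // i _; exact: mX.
apply/seteqP; split=> w /= [Bw Hw]; split => //; first by move=> i _; exact: Hw.
by move=> i; exact: Hw.
Qed.

Lemma pr_rectangle (B : set R) (H : 'I_n -> set R) :
  measurable B -> (forall i, measurable (H i)) ->
  pr [set w | B (Z w) /\ forall i, H i (X i w)] =
  (pr (Z @^-1` B) * \prod_i pr (X i @^-1` H i))%R.
Proof.
move=> mB mH.
have := @indepXZ [set: option 'I_n]%SET (fun j => if j is Some i then H i else B).
rewrite (_ : \bigcap_(j in _) _ = [set w | B (Z w) /\ forall i, H i (X i w)]); last first.
  apply/seteqP; split=> w /=; last by move=> [Bw Hw] [i|] _ //=; exact: Hw.
  by move=> Hw; split=> [|i]; [apply: (Hw None)|apply: (Hw (Some i))]; rewrite /= inE.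
rewrite prE; last exact: measurable_rectangle.
move=> /(_ _) H1; apply/EFin_inj; rewrite H1; last by case.
rewrite [LHS](eq_bigl xpredT) => [|j]; last by rewrite finset.in_setT.
rewrite (bigD1 None) //= prE; last exact: mZ.
rewrite (reindex_omap Some id) => [|[]//] /=.
rewrite [X in _ * X = _](eq_bigl xpredT) => [|j]; last by rewrite eqxx.
rewrite (eq_bigr (fun i => (pr (X i @^-1` H i))%:E)) => [|i _]; last first.
  by rewrite prE //; exact: mX.
by rewrite prodEFin EFinM.
Qed.

Section Levels.
Context {m : nat}.
Implicit Types (H : 'I_n -> set R) (N : 'I_n -> R -> 'I_m).

Let mlevel N i (a : nat) : (forall b : nat, measurable [set y | (b <= N i y)%N]) ->
  measurable [set y | N i y = a :> nat].
Proof.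
move=> mN; rewrite (_ : mkset _ = [set y | (a <= N i y)%N] `\` [set y | (a < N i y)%N]).
  by apply: measurableD.
apply/seteqP; split=> y /=; first by move=> ->; split; rewrite ?ltnn.
by move=> [ay /negP]; rewrite -leqNgt => ya; apply/eqP; rewrite eqn_leq ay ya.
Qed.

(** The event is a disjoint union of rectangles, one for each level vector c in U. Probabilities of
    exact levels are written as differences of tails to match [le_prob_upset]. *)
Lemma pr_levels (B : set R) H N (U : pred {ffun 'I_n -> 'I_m}) :
  measurable B -> (forall i, measurable (H i)) ->
  (forall i (a : nat), measurable [set y | (a <= N i y)%N]) ->
  let E := [set w | [/\ B (Z w), forall i, H i (X i w)
                      & U [ffun i => N i (X i w)]]] in
  measurable E /\
  pr E = (pr (Z @^-1` B) * \sum_(c | U c)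
    \prod_i (pr (X i @^-1` [set y | H i y /\ (c i <= N i y)%N]) -
             pr (X i @^-1` [set y | H i y /\ (c i < N i y)%N])))%R.
Proof.
move=> mB mH mN E.
pose F (c : {ffun 'I_n -> 'I_m}) :=
  [set w | B (Z w) /\ forall i, (H i `&` [set y | N i y = c i :> nat]) (X i w)].
have mHN (c : {ffun 'I_n -> 'I_m}) i :
    measurable (H i `&` [set y | N i y = c i :> nat]).
  by apply: measurableI => //; exact: mlevel.
have mF c : measurable (F c) by exact: (measurable_rectangle mB (mHN c)).
have EF : E = \bigcup_(c in [set c | U c]) F c.
  apply/seteqP; split=> w /=.
    move=> [Bw Hw Uw]; exists [ffun i => N i (X i w)] => //.
    by split => // i; split; [exact: Hw|rewrite /= ffunE].
  move=> [c Uc [Bw Hc]]; split=> // [i|]; first by case: (Hc i).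
  rewrite (_ : finfun _ = c) //; apply/ffunP => i; rewrite ffunE.
  by apply/val_inj; case: (Hc i).
have finU : finite_set [set c | U c] by exact: finite_finset.
have mE : measurable E by rewrite EF; exact: fin_bigcup_measurable.
split => //; apply/EFin_inj; rewrite -prE // EF measure_fin_bigcup //; last first.
  move=> c c' _ _ [w [[_ Hc] [_ Hc']]]; apply/ffunP => i; apply/val_inj => /=.
  by case: (Hc i) => _ /= <-; case: (Hc' i).
rewrite (_ : [set c | U c] = [set` enum U]); last first.
  by apply/seteqP; split=> c /=; rewrite mem_enum.
rewrite -fsbig_seq ?enum_uniq // big_enum /=.
rewrite mulr_sumr -sumEFin; apply: eq_bigr => c _.
rewrite prE // (pr_rectangle mB (mHN c)).
congr (_ * _)%:E%R; apply: eq_bigr => i _.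
apply: (@addIr _ (pr (X i @^-1` [set y | H i y /\ (c i < N i y)%N]))).
have mHle (a : nat) : measurable (X i @^-1` [set y | H i y /\ (a <= N i y)%N]).
  by apply: mX; exact: (measurableI _ _ (mH i) (mN i a)).
rewrite subrK; apply/EFin_inj; rewrite EFinD -!prE //; last exact: mX.
rewrite -measureU //; last 2 first.
- exact: mX.
- by apply/seteqP; split=> // w /= [[_ ->] []]; rewrite ltnn.
congr (P _); apply/seteqP; split=> w /=.
  by move=> [[Hw ->]|[Hw cN]]; split => //; exact: ltnW.
by rewrite leq_eqVlt => -[Hw /orP[/eqP <-|cN]]; [left|right].
Qed.

Let cond_probE A B : measurable A -> measurable B -> 0 < P B ->
  cond_prob P A B = (pr (A `&` B) / pr B)%:E.
Proof.
move=> mA mB; rewrite /cond_prob prE // (prE (measurableI _ _ mA mB)) lte_fin => B0.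
by rewrite inver gt_eqF // EFinM.
Qed.

(** The conditioning event is itself a rectangle, so the division is done factor by factor: given
    [A] the coordinates stay independent and Z keeps its law. *)
Lemma cond_prob_levels (B : set R) H N (U : pred {ffun 'I_n -> 'I_m}) :
  measurable B -> (forall i, measurable (H i)) ->
  (forall i (a : nat), measurable [set y | (a <= N i y)%N]) ->
  (forall i, 0 < P (X i @^-1` H i)) ->
  let p i (a : nat) :=
    fine (cond_prob P (X i @^-1` [set y | (a <= N i y)%N]) (X i @^-1` H i)) in
  let A := [set w | forall i, H i (X i w)] in
  cond_prob P [set w | B (Z w) /\ U [ffun i => N i (X i w)]] A =
  (pr (Z @^-1` B) *
   \sum_(c | U c) \prod_i (p i (c i) - p i (c i).+1))%:E.
Proof.
move=> mB mH mN H0 p A.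
have AE : A = [set w | [set: R] (Z w) /\ forall i, H i (X i w)].
  by apply/seteqP; split=> w /= => [|[]].
have mA : measurable A by rewrite AE; exact: measurable_rectangle.
have h_gt0 i : (0 < pr (X i @^-1` H i))%R.
  by rewrite -lte_fin -prE //; exact: mX.
have prA : pr A = (\prod_i pr (X i @^-1` H i))%R.
  by rewrite AE pr_rectangle // preimage_setT /pr probability_setT mul1r.
have A_gt0 : (0 < pr A)%R by rewrite prA prodr_gt0.
have [mE prE_] := pr_levels U mB mH mN.
rewrite /cond_prob (_ : _ `&` A = [set w | [/\ B (Z w), forall i, H i (X i w)
                      & U [ffun i => N i (X i w)]]]); last first.
  by apply/seteqP; split=> w /= [] => [[]|].
rewrite (prE mE) (prE mA) inver gt_eqF // -EFinM prE_; congr (_%:E).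
rewrite -mulrA; congr (_ * _)%R; rewrite mulr_suml; apply: eq_bigr => c _.
rewrite prA -prodf_div; apply: eq_bigr => i _.
have pE a : p i a = (pr (X i @^-1` [set y | H i y /\ (a <= N i y)%N]) / pr (X i @^-1` H i))%R.
  rewrite /p cond_probE //=; [|exact: mX|exact: mX].
  by rewrite -preimage_setI setIC.
by rewrite !pE mulrBl.
Qed.

(** The event on Z contributes the same factor to both sides; the rest is [le_prob_upset] for the
    conditional tails of the levels. *)
Lemma le_cond_prob_levels (B : set R) H H' N N' (U : pred {ffun 'I_n -> 'I_m}) :
  measurable B ->
  (forall i, measurable (H i)) -> (forall i, measurable (H' i)) ->
  (forall i (a : nat), measurable [set y | (a <= N i y)%N]) ->
  (forall i (a : nat), measurable [set y | (a <= N' i y)%N]) ->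
  (forall i, 0 < P (X i @^-1` H i)) -> (forall i, 0 < P (X i @^-1` H' i)) ->
  (forall i (a : nat),
    cond_prob P (X i @^-1` [set y | (a <= N i y)%N]) (X i @^-1` H i) <=
    cond_prob P (X i @^-1` [set y | (a <= N' i y)%N]) (X i @^-1` H' i)) ->
  (forall c c' : {ffun 'I_n -> 'I_m}, (forall i, (c i <= c' i)%N) -> U c -> U c') ->
  cond_prob P [set w | B (Z w) /\ U [ffun i => N i (X i w)]]
    [set w | forall i, H i (X i w)] <=
  cond_prob P [set w | B (Z w) /\ U [ffun i => N' i (X i w)]]
    [set w | forall i, H' i (X i w)].
Proof.
move=> mB mH mH' mN mN' H0 H'0 NN' upU.
rewrite (cond_prob_levels U mB mH mN H0).
rewrite (cond_prob_levels U mB mH' mN' H'0).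
have fin_cond A C : measurable A -> measurable C -> 0 < P C ->
    cond_prob P A C \is a fin_num by move=> *; rewrite cond_probE.
pose S (G : 'I_n -> set R) (M : 'I_n -> R -> 'I_m) i (a : nat) :=
  fine (cond_prob P (X i @^-1` [set y | (a <= M i y)%N]) (X i @^-1` G i)).
(* Boundary values for the coupling: every level is at least 0 and none reaches m. *)
have S0 G M : (forall i, measurable (G i)) -> (forall i, 0 < P (X i @^-1` G i)) ->
    forall i, S G M i 0%N = 1%R.
  move=> mG G0 i; rewrite /S (_ : mkset _ = setT); last by apply/seteqP; split.
  rewrite preimage_setT cond_probE //; last exact: mX.
  by rewrite setTI /= divff // gt_eqF // -lte_fin -prE //; exact: mX.
have Sm G M : forall i, S G M i m = 0%R.
  move=> i; rewrite /S (_ : mkset _ = set0) ?preimage_set0.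
    by rewrite /cond_prob set0I measure0 mul0e.
  by apply/seteqP; split=> y //=; rewrite leqNgt ltn_ord.
have S_ni (G : 'I_n -> set R) (M : 'I_n -> R -> 'I_m) :
    (forall i, measurable (G i)) -> (forall i, 0 < P (X i @^-1` G i)) ->
    (forall i (a : nat), measurable [set y | (a <= M i y)%N]) ->
    forall i, {homo S G M i : a b / (a <= b)%N >-> (b <= a)%R}.
  move=> mG G0 mM i a b ab; apply: fine_le.
  - by apply: fin_cond => //; exact: mX.
  - by apply: fin_cond => //; exact: mX.
  rewrite /cond_prob lee_wpmul2r ?inve_ge0 //.
  apply: le_measure; rewrite ?inE; try by apply: measurableI; exact: mX.
  by apply: setSI => w /=; exact: leq_trans.
have bR : (0 <= pr (Z @^-1` B))%R by rewrite fine_ge0.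
rewrite lee_fin ler_wpM2l //.
apply: (le_prob_upset (p := S H N) (q := S H' N')) => //.
- exact: S0.
- exact: S0.
- exact: S_ni.
- exact: S_ni.
- by move=> i a; apply: fine_le => //; apply: fin_cond => //; exact: mX.
Qed.

End Levels.
End Independence.

(** * Measurability of order statistics and of the standby lifetime *)

Lemma measurable_gtr d (T : measurableType d) (R : realType) (f : T -> R) (v : R) :
  measurable_fun setT f -> measurable [set w | (v < f w)%R].
Proof.
move=> mf; rewrite (_ : mkset _ = f @^-1` `]v, +oo[%classic).
  by rewrite -[_ @^-1` _]setTI; exact: mf.
by apply/seteqP; split=> w /=; rewrite in_itv /= andbT.
Qed.

Section StandbyMeasurability.
Context {d : measure_display} {Omega : measurableType d} {R : realType} {n : nat}.
Variables (X : 'I_n -> Omega -> R).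
Hypothesis mX : forall i, measurable_fun setT (X i).

Lemma measurable_order_stat r :
  measurable_fun setT (fun w => order_stat (fun i => X i w) r.+1).
Proof.
apply: (measurability _ (ErealGenOInfty.measurableE R)).
move=> _ [_ [v ->] <-]; rewrite setTI.
(* The order statistic exceeds v exactly when all variables outside some set J of at most r indices
   do. *)
rewrite (_ : _ @^-1` _ = \bigcup_(J in [set J : {set 'I_n} | (#|J| <= r)%N])
  \bigcap_(i in [set i | i \notin J]) [set w | (v < X i w)%R]).
  apply: fin_bigcup_measurable => [|J _]; first exact: finite_finset.
  apply: fin_bigcap_measurable => [|i _]; first exact: finite_finset.
  exact: measurable_gtr.
apply/seteqP; split=> w /=; rewrite in_itv /= andbT lt_order_stat.
  move=> Jr; exists [set i | (X i w <= v)%R]%SET => // i /=.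
  by rewrite inE -ltNge.
move=> [J /= Jr vX]; apply: leq_trans Jr; apply: subset_leq_card.
apply/fintype.subsetP => i; rewrite inE; apply: contraLR => iJ.
by rewrite -ltNge; exact: vX.
Qed.

Lemma measurable_standby_lifetime k (Z : Omega -> R) : measurable_fun setT Z ->
  measurable_fun setT (fun w => standby_lifetime k (fun i => X i w) (Z w)).
Proof.
move=> mZ; rewrite /standby_lifetime addn1 addn2; apply: measurable_mine.
  apply: emeasurable_funD; first exact: measurable_order_stat.
  exact/measurable_EFinP.
exact: measurable_order_stat.
Qed.

End StandbyMeasurability.

Lemma le_standby_lifetime (R : realType) n k (x : 'I_n -> R) (z z' : R) :
  (z <= z')%R -> standby_lifetime k x z <= standby_lifetime k x z'.
Proof.
move=> zz'; rewrite /standby_lifetime le_min ge_min ge_min lexx orbT andbT.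
by rewrite leeD2l.
Qed.

(** * Comparison for a standby lifetime held at a constant z *)

Section Standby.
Context {d : measure_display} {Omega : measurableType d} {R : realType}.
Variables (P : probability Omega R) (n k : nat).
Variables (X : 'I_n -> {RV P >-> R}) (Z : {RV P >-> R}).
Hypothesis indepXZ :
  mutually_independent (fun j : option 'I_n => if j is Some i then X i else Z).

(* By [lt_standby_lifetime], level 0 is a failure by time t + s - z, level 1 one
   in (t + s - z, t + s], level 2 survival to t + s. *)
Let level (t s z y : R) : 'I_3 := inord ((s - z < y - t)%R + (s < y - t)%R).

(** As z >= 0, the second inequality implies the first, so their number is at least a exactly when
    the a-th holds. The default [false] covers a > 2. *)
Let levelE t s z y (a : nat) : (0 <= z)%R ->
  (a <= level t s z y)%N = nth false [:: true; (s - z < y - t)%R; (s < y - t)%R] a.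
Proof.
move=> z0; rewrite inordK; last by do 2! case: (_ < _)%R.
have : ((s < y - t) ==> (s - z < y - t))%R.
  by apply/implyP => ?; lra.
by case: a => [|[|[|a]]]; do 2! case: (_ < _)%R => //=; rewrite nth_nil.
Qed.

Let alive (t : R) := [set w | forall i, (t < X i w)%R].

(** The order of t and t' is left open so that the result serves both IFR and DFR. The set B will
    later be the event that a simple function of Z takes the value z. *)
Lemma le_cond_prob_standby_fixed (B : set R) (t t' s z : R) :
  measurable B -> (0 <= z)%R ->
  (forall i, 0 < P [set w | (t < X i w)%R]) ->
  (forall i, 0 < P [set w | (t' < X i w)%R]) ->
  (forall i s, residual_survival (X i) t s <= residual_survival (X i) t' s) ->
  cond_prob P [set w | B (Z w) /\
    (s + t)%:E < standby_lifetime k (fun i => X i w) z] (alive t) <=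
  cond_prob P [set w | B (Z w) /\
    (s + t')%:E < standby_lifetime k (fun i => X i w) z] (alive t').
Proof.
move=> mB z0 t0 t'0 tt'.
(* At most n - k components at level 0 and at most n - k + 1 below level 2; raising levels preserves
   this. *)
pose U (c : {ffun 'I_n -> 'I_3}) :=
  (#|[set i | ~~ (1 <= c i)]%SET| <= n - k)%N &&
  (#|[set i | ~~ (2 <= c i)]%SET| <= (n - k).+1)%N.
have eventE u w : (s + u)%:E < standby_lifetime k (fun i => X i w) z =
    U [ffun i => level u s z (X i w)].
  rewrite lt_standby_lifetime /U; congr (_ && _); congr (#|pred_of_set _| <= _)%N;
    by apply/setP => i; rewrite !inE ffunE levelE //= -leNgt; apply/idP/idP => ?; lra.
have event_eq u : [set w | B (Z w) /\
    (s + u)%:E < standby_lifetime k (fun i => X i w) z] =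
    [set w | B (Z w) /\ U [ffun i => level u s z (X i w)]].
  by apply/seteqP; split=> w /=; rewrite eventE.
rewrite !event_eq.
have mgt (a u : R) : measurable [set y : R | (a < y - u)%R].
  by apply: measurable_gtr; exact: measurable_funB.
have level_set (u : R) a : [set y | (a <= level u s z y)%N] =
    nth set0 [:: setT; [set y | (s - z < y - u)%R]; [set y | (s < y - u)%R]] a.
  by apply/seteqP; case: a => [|[|[|a]]]; split=> y //=; rewrite levelE //= nth_nil.
have mlevel (u : R) (a : nat) : measurable [set y : R | (a <= level u s z y)%N].
  by rewrite level_set; case: a => [|[|[|a]]] //=; rewrite nth_nil.
have cond_setT i u : 0 < P [set w | (u < X i w)%R] ->
    cond_prob P setT (X i @^-1` [set y | (u < y)%R]) = 1.
  move=> u0; rewrite /cond_prob setTI divee ?gt_eqF // fin_num_measure //.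
  exact: (measurable_gtr (f := X i)).
apply: (le_cond_prob_levels indepXZ (H := fun _ => [set y | (t < y)%R])
  (H' := fun _ => [set y | (t' < y)%R]) (N := fun=> level t s z)
  (N' := fun=> level t' s z)) => //.
- by move=> i; exact: measurable_gtr.
- by move=> i; exact: measurable_gtr.
(* Level 0 is certain, levels 1 and 2 are the hypothesis at s - z and at s, and higher levels are
   impossible. *)
- move=> i a; rewrite !level_set; case: a => [|[|[|a]]] /=.
  + by rewrite !preimage_setT !cond_setT.
  + exact: tt'.
  + exact: tt'.
  + by rewrite nth_nil !preimage_set0 /cond_prob !set0I measure0 !mul0e.
- move=> c c' cc' /andP[c1 c2]; apply/andP; split.
    apply: leq_trans c1; apply: subset_leq_card; apply/fintype.subsetP => i.
    by rewrite !inE; apply: contra => ci; exact: leq_trans (cc' i).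
  apply: leq_trans c2; apply: subset_leq_card; apply/fintype.subsetP => i.
  by rewrite !inE; apply: contra => ci; exact: leq_trans (cc' i).
Qed.
End Standby.

(** * From a constant to a random standby lifetime *)

Section StandbyOrder.
Import HBSimple HBNNSimple.
Context {d : measure_display} {Omega : measurableType d} {R : realType}.
Variables (P : probability Omega R) (n k : nat).
Variables (X : 'I_n -> {RV P >-> R}) (Z : {RV P >-> R}).
Hypothesis indepXZ :
  mutually_independent (fun j : option 'I_n => if j is Some i then X i else Z).

Let alive (t : R) := [set w | forall i, (t < X i w)%R].

Lemma measurable_lt_standby (W : Omega -> R) (v : R) : measurable_fun setT W ->
  measurable [set w | v%:E < standby_lifetime k (fun i => X i w) (W w)].
Proof.
move=> mW; rewrite -[mkset _]setTI; apply: emeasurable_fun_o_infty => //.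
by apply: measurable_standby_lifetime.
Qed.

Lemma measurable_alive t : measurable (alive t).
Proof.
rewrite (_ : alive t = \bigcap_(i in [set: 'I_n]) [set w | (t < X i w)%R]).
  by apply: fin_bigcap_measurable => // i _; exact: measurable_gtr.
by apply/seteqP; split=> w /= Hw i; [move=> _|]; exact: Hw.
Qed.

Lemma le_cond_prob_standby_simple (phi : {nnsfun R >-> R}) (t t' s : R) :
  (forall i, 0 < P [set w | (t < X i w)%R]) ->
  (forall i, 0 < P [set w | (t' < X i w)%R]) ->
  (forall i s, residual_survival (X i) t s <= residual_survival (X i) t' s) ->
  cond_prob P [set w |
    (s + t)%:E < standby_lifetime k (fun i => X i w) (phi (Z w))] (alive t) <=
  cond_prob P [set w |
    (s + t')%:E < standby_lifetime k (fun i => X i w) (phi (Z w))] (alive t').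
Proof.
move=> t0 t'0 tt'.
pose F u z := [set w | (phi @^-1` [set z]) (Z w) /\
  (s + u)%:E < standby_lifetime k (fun i => X i w) z].
have mphi z : measurable (phi @^-1` [set z]).
  by rewrite -[_ @^-1` _]setTI; exact: measurable_funP.
have mZ (D : set R) : measurable D -> measurable [set w | D (Z w)].
  move=> mD; suff : measurable (Z @^-1` D) by [].
  by rewrite -[_ @^-1` _]setTI; exact: measurable_funP.
have mF u z : measurable (F u z `&` alive u).
  apply: measurableI; last exact: measurable_alive.
  by apply: measurableI; [exact: mZ (mphi z)|exact: measurable_lt_standby].
(* A simple function has finitely many values; on each piece the standby lifetime is a constant z >=
   0. *)
have split_range u : cond_prob P [set w |
    (s + u)%:E < standby_lifetime k (fun i => X i w) (phi (Z w))] (alive u) =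
    \sum_(z \in range phi) cond_prob P (F u z) (alive u).
  rewrite /cond_prob -ge0_mule_fsuml // -measure_fin_bigcup //.
  - congr (P _ / _); rewrite -setI_bigcupl; congr (_ `&` _).
    apply/seteqP; split=> w /=; first by move=> sw; exists (phi (Z w)) => //; exists (Z w).
    by move=> [_ _ [/= <-]].
  - by move=> z z' _ _ [w [[[/= <- _] _] [[/= <- _] _]]].
rewrite !split_range; apply: lee_fsum => // z [y _ <-].
exact: le_cond_prob_standby_fixed.
Qed.

Lemma le_cond_prob_standby (t t' s : R) : (1 <= k <= n)%N ->
  (forall w, (0 <= Z w)%R) -> 0 < P (alive t) ->
  (forall i, 0 < P [set w | (t < X i w)%R]) ->
  (forall i, 0 < P [set w | (t' < X i w)%R]) ->
  (forall i s, residual_survival (X i) t s <= residual_survival (X i) t' s) ->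
  cond_prob P [set w |
    (s + t)%:E < standby_lifetime k (fun i => X i w) (Z w)] (alive t) <=
  cond_prob P [set w |
    (s + t')%:E < standby_lifetime k (fun i => X i w) (Z w)] (alive t').
Proof.
move=> /andP[k0 kn] Z0 A0 t0 t'0 tt'.
(* The approximation by simple functions needs a nonnegative function on the whole line; the
   absolute value agrees with the identity on the values of Z. *)
have mabs : measurable_fun [set: R] (fun y : R => `|y|%:E).
  apply/measurable_EFinP; exact: (measurableT_comp (@normr_measurable R setT)).
pose phi := nnsfun_approx measurableT mabs.
pose E m u := [set w |
  (s + u)%:E < standby_lifetime k (fun i => X i w) (phi m (Z w))].
have mE m u : measurable (E m u).
  by apply: measurable_lt_standby; apply: measurableT_comp.
have phi_le m w : (phi m (Z w) <= Z w)%R.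
  rewrite -lee_fin /phi nnsfun_approxE -{2}(ger0_norm (Z0 w)).
  exact: (le_approx (D := [set: R]) (f := fun y : R => `|y|%:E)).
have cupE u : \bigcup_m E m u =
    [set w | (s + u)%:E < standby_lifetime k (fun i => X i w) (Z w)].
  apply/seteqP; split=> w /=.
    by move=> [m _ /lt_le_trans]; apply; exact: le_standby_lifetime.
  have nkn : (n - k < n)%N by rewrite ltn_subrL k0 (leq_trans k0).
  rewrite /standby_lifetime /E /mkset /standby_lifetime addn1 addn2.
  rewrite lt_min => /andP[lt1 lt2].
  (* With this term finite, the claim is that some approximation exceeds s + u - a; otherwise the
     limit Z would not exceed it either, against the strict inequality. *)
  have [a os1] : exists a, order_stat (fun i => X i w) (n - k).+1 = a%:E.
    exists (fine (order_stat (fun i => X i w) (n - k).+1)).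
    by rewrite fineK // order_stat_fin_num.
  move: lt1; rewrite os1 -EFinD lte_fin => lt1.
  apply: contrapT => noE.
  have cvg_phi : (phi m (Z w))%:E @[m --> \oo] --> (`|Z w|)%:E.
    exact: (cvg_nnsfun_approx measurableT mabs).
  have : ((`|Z w|)%:E <= (s + u - a)%:E)%E.
    apply: cvge_le cvg_phi; apply: nearW => m; rewrite lee_fin leNgt.
    apply/negP => lt_phi; apply: noE; exists m => //=.
    by rewrite os1 lt_min lt2 andbT -EFinD lte_fin -ltrBlDl.
  by rewrite lee_fin ger0_norm // => Zle; move: lt1; rewrite ltNge -lerBrDl Zle.
have nd_E u : nondecreasing_seq (fun m => E m u `&` alive u).
  move=> m m' mm'; apply/subsetPset; apply: setSI => w /= /lt_le_trans; apply.
  by apply: le_standby_lifetime; have /lefP := nd_nnsfun_approx measurableT mabs mm'.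
have cvgE : P (E m t `&` alive t) / P (alive t) @[m --> \oo] -->
    cond_prob P (\bigcup_m E m t) (alive t).
  rewrite /cond_prob setI_bigcupl; apply: cvgeZr; last first.
    apply: nondecreasing_cvg_mu => //.
    - by move=> m; apply: measurableI => //; exact: measurable_alive.
    - by apply: bigcupT_measurable => m; apply: measurableI => //; exact: measurable_alive.
  by rewrite fin_numV //; [rewrite gt_eqF|case: (P _) A0].
(* The left side is a limit by continuity from below; on the right each event is bounded by the
   union. *)
rewrite -!cupE; apply: cvge_le cvgE; apply: nearW => m.
apply: (le_trans (le_cond_prob_standby_simple (phi m) s t0 t'0 tt')).
rewrite /cond_prob lee_wpmul2r ?inve_ge0 //.
apply: le_measure; rewrite ?inE.
- by apply: measurableI; [exact: mE|exact: measurable_alive].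
- apply: measurableI; last exact: measurable_alive.
  exact: bigcupT_measurable.
- by apply: setSI => w Ew; exists m.
Qed.
End StandbyOrder.

(** * Conditional means as integrals of conditional tails *)

Section TailExpectation.
Context {d : measure_display} {Omega : measurableType d} {R : realType}.
Variables (P : probability Omega R) (A : set Omega) (f : Omega -> R).
Hypotheses (mA : measurable A) (mf : measurable_fun setT f).
Hypothesis f_ge0 : forall w, A w -> (0 <= f w)%R.

Let tail (r : R) := cond_prob P [set w | (r < f w)%R] A.

(** Tail formula for the nonnegative variable equal to f on A and 0 elsewhere, divided by P(A). For
    r >= 0 that variable exceeds r only inside A, which yields the conditional tail. *)
Lemma cond_expectation_tail :
  measurable_fun (`[0%R, +oo[%classic : set R) tail /\
  cond_expectation P (EFin \o f) A = \int[lebesgue_measure]_(r in `[0%R, +oo[) tail r.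
Proof.
pose g := (f \_ A)%R.
have mg : measurable_fun setT g.
  by apply/(measurable_restrictT f mA); exact: measurable_funTS.
pose Y : {RV P >-> R} := HB.pack g (isMeasurableFun.Build _ _ _ _ g mg).
have Y_ge0 w : (0 <= Y w)%R.
  by rewrite /Y /= /g patchE; case: ifPn => // /set_mem /f_ge0.
have tailE r : r \in `[0%R, +oo[%classic -> tail r = ccdf Y r * (P A)^-1.
  rewrite inE /= in_itv /= andbT => r0; rewrite /tail /cond_prob; congr (_ * _).
  rewrite /ccdf /distribution /pushforward; congr (P _).
  apply/seteqP; split=> w /=; rewrite in_itv /= andbT /g patchE.
    by move=> [rf Aw]; rewrite mem_set.
  by case: ifPn => [/set_mem //|_]; rewrite ltNge r0.
have iPA : 0 <= (P A)^-1 by rewrite inve_ge0.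
have mccdf D : measurable_fun D (ccdf Y) by apply: measurable_funTS; exact: ccdf_measurable.
split.
  apply: (eq_measurable_fun (fun r => ccdf Y r * (P A)^-1)) => [r rI|].
    by rewrite tailE.
  by apply: emeasurable_funM.
transitivity (\int[lebesgue_measure]_(r in `[0%R, +oo[) (ccdf Y r * (P A)^-1)); last first.
  by apply: eq_integral => r rI; rewrite tailE.
rewrite ge0_integralZr //; last exact: mccdf.
rewrite -ge0_expectation_ccdf // /cond_expectation; congr (_ * _).
rewrite unlock integral_mkcond; apply: eq_integral => w _.
by rewrite /= /g !patchE; case: ifP.
Qed.

End TailExpectation.

Lemma le_cond_expectation d (Omega : measurableType d) (R : realType)
  (P : probability Omega R) (A B : set Omega) (f g : Omega -> R) :
  measurable A -> measurable B ->
  measurable_fun setT f -> measurable_fun setT g ->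
  (forall w, A w -> (0 <= f w)%R) -> (forall w, B w -> (0 <= g w)%R) ->
  (forall r, cond_prob P [set w | (r < f w)%R] A <=
             cond_prob P [set w | (r < g w)%R] B) ->
  cond_expectation P (EFin \o f) A <= cond_expectation P (EFin \o g) B.
Proof.
move=> mA mB mf mg f0 g0 fg.
have [mtf ->] := cond_expectation_tail P mA mf f0.
have [mtg ->] := cond_expectation_tail P mB mg g0.
apply: ge0_le_integral => // r _.
by rewrite /cond_prob mule_ge0 ?inve_ge0.
Qed.

(** * The residual lifetime given survival of all components *)

Section ResidualLifetimes.
Context {d : measure_display} {Omega : measurableType d} {R : realType}.
Variables (P : probability Omega R) (n k : nat).
Variables (X : 'I_n -> {RV P >-> R}) (Z : {RV P >-> R}).
Hypothesis indepXZ :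
  mutually_independent (fun j : option 'I_n => if j is Some i then X i else Z).
Hypotheses (kn : (1 <= k <= n)%N) (Z_ge0 : forall w, (0 <= Z w)%R).

Let X1_gt (t : R) := [set w | t%:E < order_stat (fun i => X i w) 1].
Let T w := standby_lifetime k (fun i => X i w) (Z w).

Lemma X1_gtE t : X1_gt t = [set w | forall i, (t < X i w)%R].
Proof. by apply/seteqP; split=> w /= /lt_order_stat1. Qed.

Lemma survival_gt0 t i : 0 < P (X1_gt t) -> 0 < P [set w | (t < X i w)%R].
Proof.
rewrite X1_gtE => /lt_le_trans; apply; apply: le_measure; rewrite ?inE.
- exact: measurable_alive.
- exact: measurable_gtr.
- by move=> w; apply.
Qed.

Let residual_law t := cond_law P (fun w => T w - t%:E) (X1_gt t).
Let residual_mean t := cond_expectation P (fun w => T w - t%:E) (X1_gt t).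

Lemma le_residual_law t t' : 0 < P (X1_gt t) -> 0 < P (X1_gt t') ->
  (forall i s, residual_survival (X i) t s <= residual_survival (X i) t' s) ->
  st_le (residual_law t) (residual_law t').
Proof.
move=> t0 t'0 tt' s; rewrite /residual_law /cond_law.
have lawE u : (fun w => T w - u%:E) @^-1` [set y | s%:E < y] =
    [set w | (s + u)%:E < T w].
  by apply/seteqP; split=> w; rewrite /preimage /mkset EFinD lteBrDr.
rewrite !lawE !X1_gtE; apply: le_cond_prob_standby => //.
- by rewrite -X1_gtE.
- by move=> i; exact: survival_gt0.
- by move=> i; exact: survival_gt0.
Qed.

Lemma le_residual_mean t t' : 0 < P (X1_gt t) -> 0 < P (X1_gt t') ->
  (forall i s, residual_survival (X i) t s <= residual_survival (X i) t' s) ->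
  residual_mean t <= residual_mean t'.
Proof.
move=> t0 t'0 tt'; have law_le := le_residual_law t0 t'0 tt'.
(* T is finite because 1 <= k <= n, so the tail formula for real-valued functions applies. *)
pose f u w := (fine (T w) - u)%R.
have TE u : (fun w => T w - u%:E) = EFin \o f u.
  by apply/funext => w; rewrite /= EFinB fineK // standby_lifetime_fin_num.
have mX1 u : measurable (X1_gt u) by rewrite X1_gtE; exact: measurable_alive.
have mT : measurable_fun setT T by exact: measurable_standby_lifetime.
have mf u : measurable_fun setT (f u).
  apply: measurable_funB => //; exact: (measurableT_comp (fine_measurable _)).
(* While all components survive u, the system does too. *)
have f_ge0 u w : X1_gt u w -> (0 <= f u w)%R.
  move=> /lt_order_stat1 uX; rewrite subr_ge0 -lee_fin.
  by rewrite fineK ?standby_lifetime_fin_num // ltW // lt_standby_lifetime_min.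
rewrite /residual_mean !TE; apply: le_cond_expectation => //.
- exact: f_ge0.
- exact: f_ge0.
move=> r; have := law_le r; rewrite /residual_law /cond_law !TE.
exact.
Qed.

End ResidualLifetimes.
Theorem theorem4p4 (d : measure_display) (Omega : measurableType d)
    (R : realType) (P : probability Omega R) (n k : nat)
    (X : 'I_n -> {RV P >-> R}) (Z : {RV P >-> R}) (S : set R) :
  (1 <= k <= n)%N ->
  (forall i w, (0 <= X i w)%R) -> (forall w, (0 <= Z w)%R) ->
  mutually_independent (fun j : option 'I_n => if j is Some i then X i else Z) ->
  (forall i, rv_support (X i) = S) ->
  (forall i, continuous_on_interval (X i)) \/
    (exists N : option nat, forall i, discrete_on_nats N (X i)) ->
  let X1_gt (t : R) : set Omega :=
    [set w | t%:E < order_stat (fun i => X i w) 1] in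
  let T (w : Omega) : \bar R := standby_lifetime k (fun i => X i w) (Z w) in
  let TT : set R := [set t | S t /\ 0 < P (X1_gt t)] in
  let residual_law (t : R) := cond_law P (fun w => T w - t%:E) (X1_gt t) in
  let residual_mean (t : R) :=
    cond_expectation P (fun w => T w - t%:E) (X1_gt t) in
  ((forall i, IFR (X i)) ->
     (forall t1 t2 : R, (t1 < t2)%R -> TT t1 -> TT t2 ->
        st_le (residual_law t2) (residual_law t1)) /\
     (forall t1 t2 : R, (t1 <= t2)%R -> TT t1 -> TT t2 ->
        residual_mean t2 <= residual_mean t1)) /\
  ((forall i, DFR (X i)) ->
     (forall t1 t2 : R, (t1 < t2)%R -> TT t1 -> TT t2 ->
        st_le (residual_law t1) (residual_law t2)) /\
     (forall t1 t2 : R, (t1 <= t2)%R -> TT t1 -> TT t2 ->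
        residual_mean t1 <= residual_mean t2)).
Proof.
move=> kn X_ge0 Z_ge0 indep suppX _ X1_gt T TT residual_law residual_mean.
split=> fr.
(* Both times lie in the common support, and survival of all components past t2 with positive
   probability gives the same for each X i. *)
- have order (t1 t2 : R) : (t1 <= t2)%R -> TT t1 -> TT t2 -> forall i s,
      residual_survival (X i) t2 s <= residual_survival (X i) t1 s.
    move=> t12 [St1 _] [St2 t2_gt0] i; apply: (fr i).2; rewrite ?suppX //.
    exact: survival_gt0 t2_gt0.
  split=> t1 t2 t12 Tt1 Tt2.
    by apply: le_residual_law Tt2.2 Tt1.2 (order _ _ (ltW t12) Tt1 Tt2).
  by apply: le_residual_mean Tt2.2 Tt1.2 (order _ _ t12 Tt1 Tt2).
- have order (t1 t2 : R) : (t1 <= t2)%R -> TT t1 -> TT t2 -> forall i s,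
      residual_survival (X i) t1 s <= residual_survival (X i) t2 s.
    move=> t12 [St1 _] [St2 t2_gt0] i; apply: (fr i).2; rewrite ?suppX //.
    exact: survival_gt0 t2_gt0.
  split=> t1 t2 t12 Tt1 Tt2.
    by apply: le_residual_law Tt1.2 Tt2.2 (order _ _ (ltW t12) Tt1 Tt2).
  by apply: le_residual_mean Tt1.2 Tt2.2 (order _ _ t12 Tt1 Tt2).
Qed.
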